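(* There exist $\alpha\in[0,\pi/2]$ and $C>0$ such that for all $k\in\mathbb N$ (that is, $k\geq 1$), all $p\in\mathbb Z$ and all $q\in\mathbb N$ (that is, $q\geq 1$) we have $$\left|\tan\left(\alpha-2^{-k}\right)-\frac pq\right|>\frac{C}{q^2\log^2q}.$$
   Context: $\log n$ stands for $\max\{1,\log_2 n\}$. *)

(* Defs.v *)
From Stdlib Require Import Reals.
Open Scope R_scope.

(** The truncated binary logarithm [max {1, log_2 x}]. *)
Definition log (x : R) : R := Rmax 1 (ln x / ln 2).

(* Main.v *)
Require Import Defs.
From Stdlib Require Import Reals.
From Stdlib Require Import Lra Lia IndefiniteDescription.
From Coquelicot Require Import Rcomplements.
Open Scope R_scope.

(** The Peres-Schlag method. For [q] of size about [2 ^ n] only the shifts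
    [2 ^ - k] with [k = O(n)], together with the shift 0, have to be considered:
    smaller shifts are absorbed by the radius of the forbidden neighbourhoods.
    The forbidden set of level [n] then has density [O(1 / n)] in every interval
    of length at least [2 ^ - n], and it can be resolved by intervals of length
    about [4 ^ - n / n ^ 2]. The sum of [1 / n] diverges, but it is bounded over a
    block [N <= n < 4 N]. One therefore constructs nested intervals, one per
    block, such that each interval misses the earlier blocks and meets the next
    one in proportion at most 1/2. An interval of this kind is still long enough
    for the block after the next to have density at most 1/8 in it, and repeated
    halving finds a subinterval which misses the next block and inherits the
    property. Densities are measured by the increments of a distribution
    function, which makes the averaging over the two halves a telescoping sum. *)

(** * Tangent increments, rounding and the mass near the integers *)

Lemma tan_sub_bounds (x y : R) :
  0 <= x -> x <= y -> y <= 3 / 4 -> y - x <= tan y - tan x <= 2 * (y - x).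
Proof.
  intros Hx Hxy Hy.
  destruct (Rle_lt_or_eq_dec x y Hxy) as [Hlt | ->]; [ | lra ].
  pose proof PI2_3_2 as Hpi.
  destruct (MVT_cor2 tan (fun c => 1 + tan c ^ 2) x y Hlt) as [c [Hc Hcxy]].
  { intros c Hc. assert (Hc' : - PI / 2 < c < PI / 2) by lra.
    exact (derive_pt_eq_1 _ _ _ _ (derive_pt_tan c Hc')). }
  assert (0 < tan c) by (apply tan_gt_0; lra).
  (* The derivative stays between 1 and 2, since [3 / 4 < PI / 4]. *)
  assert (tan c < 1).
  { rewrite <- tan_PI4. apply tan_increasing; lra. }
  assert (0 <= tan c ^ 2 <= 1) by nra.
  rewrite Hc. nra.
Qed.

Definition round (u : R) : Z := Int_part (u + 1 / 2).

Lemma round_bounds (u : R) : u - 1 / 2 < IZR (round u) <= u + 1 / 2.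
Proof.
  unfold round. destruct (base_Int_part (u + 1 / 2)). lra.
Qed.

Lemma round_le (u v : R) : u <= v -> (round u <= round v)%Z.
Proof.
  intros Huv. pose proof (round_bounds u). pose proof (round_bounds v).
  assert (round u < round v + 1)%Z; [ | lia ].
  apply lt_IZR. rewrite plus_IZR. lra.
Qed.

Lemma round_near (u : R) (p : Z) : Rabs (u - IZR p) < 1 / 2 -> round u = p.
Proof.
  intros H. apply Rabs_def2 in H. pose proof (round_bounds u).
  assert (round u < p + 1)%Z by (apply lt_IZR; rewrite plus_IZR; lra).
  assert (p < round u + 1)%Z by (apply lt_IZR; rewrite plus_IZR; lra).
  lia.
Qed.

(* The distribution function of Lebesgue measure restricted to the
   [2 * delta]-neighbourhood of the integers. *)
Definition near_int_mass (delta u : R) : R :=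
  4 * delta * IZR (round u)
  + Rmax (- (2 * delta)) (Rmin (2 * delta) (u - IZR (round u))).

Section NearIntMass.

Variable delta : R.
Hypothesis delta_pos : 0 <= delta.

Lemma near_int_mass_bounds (u : R) :
  4 * delta * IZR (round u) - 2 * delta <= near_int_mass delta u
    <= 4 * delta * IZR (round u) + 2 * delta.
Proof.
  unfold near_int_mass, Rmax, Rmin. repeat destruct Rle_dec; lra.
Qed.

Lemma near_int_mass_le (u v : R) :
  u <= v -> near_int_mass delta u <= near_int_mass delta v.
Proof.
  intros Huv. destruct (Z.eq_dec (round u) (round v)) as [E | E].
  - unfold near_int_mass. rewrite E. unfold Rmax, Rmin.
    repeat destruct Rle_dec; lra.
  - pose proof (round_le u v Huv).
    assert (IZR (round u) + 1 <= IZR (round v)).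
    { rewrite <- plus_IZR. apply IZR_le. lia. }
    pose proof (near_int_mass_bounds u). pose proof (near_int_mass_bounds v).
    nra.
Qed.

(** The 2 is one unit from the two roundings and one from the two clamped terms. *)
Lemma near_int_mass_sub_le (u v : R) :
  near_int_mass delta v - near_int_mass delta u <= 4 * delta * (v - u + 2).
Proof.
  pose proof (near_int_mass_bounds u). pose proof (near_int_mass_bounds v).
  pose proof (round_bounds u). pose proof (round_bounds v). nra.
Qed.

(** As [delta < 1 / 4], both points round to [p], and neither clamp is active. *)
Lemma near_int_mass_sub (u v : R) (p : Z) :
  delta < 1 / 4 ->
  Rabs (u - IZR p) <= 2 * delta -> Rabs (v - IZR p) <= 2 * delta ->
  near_int_mass delta v - near_int_mass delta u = v - u.
Proof.
  intros Hd Hu Hv. unfold near_int_mass.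
  rewrite (round_near u p), (round_near v p) by lra.
  apply Rabs_le_between in Hu. apply Rabs_le_between in Hv.
  rewrite !Rmin_right, !Rmax_right by (try rewrite Rmin_right; lra). lra.
Qed.

End NearIntMass.

(** * Detecting functions and sparse sets *)

(** [G] stands for the distribution function of a thickening of [P]: an interval no longer than [s]
    on which [G] rises by less than its length misses [P]. *)
Definition detects (G : R -> R) (P : R -> Prop) (s : R) : Prop :=
  (forall x y, 1 / 2 <= x -> x <= y -> y <= 3 / 4 -> G x <= G y) /\
  (forall x z y, 1 / 2 <= x -> x <= z <= y -> y <= 3 / 4 -> y - x <= s ->
     P z -> y - x <= G y - G x).

(* [P] occupies a proportion at most [eps] of every interval of length at least
   [lam], when [P] is thickened at scale [s]. *)
Definition sparse (P : R -> Prop) (s lam eps : R) : Prop :=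
  exists G, detects G P s /\
    forall x y, 1 / 2 <= x -> y <= 3 / 4 -> lam <= y - x ->
      G y - G x <= eps * (y - x).

Lemma sparse_empty (P : R -> Prop) (s lam eps : R) :
  0 <= lam -> 0 <= eps -> (forall z, ~ P z) -> sparse P s lam eps.
Proof.
  intros Hlam Heps HP. exists (fun _ => 0). repeat split.
  - intros; lra.
  - intros x z y _ _ _ _ Hz. elim (HP z Hz).
  - intros; nra.
Qed.

(** The functions are added. Overlaps count twice, which an upper bound tolerates, and each summand
    is monotone, so it cannot spoil what the other detects. *)
Lemma sparse_or (P Q : R -> Prop) (s lam eps1 eps2 : R) :
  sparse P s lam eps1 -> sparse Q s lam eps2 ->
  sparse (fun z => P z \/ Q z) s lam (eps1 + eps2).
Proof.
  intros [G [[Gm Gh] Ge]] [H [[Hm Hh] He]].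
  exists (fun x => G x + H x). repeat split.
  - intros x y h1 h2 h3. specialize (Gm x y h1 h2 h3).
    specialize (Hm x y h1 h2 h3). lra.
  - intros x z y h1 h2 h3 h4 h5.
    specialize (Gm x y h1 ltac:(lra) h3). specialize (Hm x y h1 ltac:(lra) h3).
    destruct h5 as [h5 | h5].
    + specialize (Gh x z y h1 h2 h3 h4 h5). lra.
    + specialize (Hh x z y h1 h2 h3 h4 h5). lra.
  - intros x y h1 h2 h3. specialize (Ge x y h1 h2 h3).
    specialize (He x y h1 h2 h3). lra.
Qed.

Lemma sparse_sub (P Q : R -> Prop) (s lam eps : R) :
  (forall z, 1 / 2 <= z <= 3 / 4 -> Q z -> P z) ->
  sparse P s lam eps -> sparse Q s lam eps.
Proof.
  intros HQP [G [[Gm Gh] Ge]]. exists G. repeat split; trivial.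
  intros x z y h1 h2 h3 h4 h5. apply (Gh x z y); trivial. apply HQP; trivial. lra.
Qed.

Lemma sparse_exists (P : nat -> R -> Prop) (s lam eps : R) (n : nat) :
  0 <= lam ->
  (forall i, (i < n)%nat -> sparse (P i) s lam eps) ->
  sparse (fun z => exists i, (i < n)%nat /\ P i z) s lam (INR n * eps).
Proof.
  intros Hlam. induction n as [ | n IH]; intros HP.
  - apply sparse_empty; [ lra | simpl; lra | ]. intros z [i [Hi _]]. lia.
  - rewrite S_INR, Rmult_plus_distr_r, Rmult_1_l.
    eapply sparse_sub; [ | apply sparse_or; [ apply IH | apply (HP n) ] ].
    + intros z _ [i [Hi Hz]]. destruct (Nat.eq_dec i n) as [-> | Hn].
      * right; exact Hz.
      * left; exists i; split; [ lia | exact Hz ].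
    + intros i Hi. apply HP. lia.
    + lia.
Qed.

(** [near_int_mass] is pulled back along [q * tan (x - sigma)] and divided by [q]. An interval of
    length at most [s] moves the argument by at most [2 * q * s <= delta], so if it meets the set it
    stays in the doubled neighbourhood, where the mass has slope 1. *)
Lemma sparse_tan_near_int (q sigma delta s lam : R) :
  0 < q -> 0 <= sigma <= 1 / 2 -> 0 <= delta < 1 / 4 ->
  2 * q * s <= delta -> / q <= 4 * lam ->
  sparse (fun z => exists p : Z, Rabs (q * tan (z - sigma) - IZR p) <= delta)
    s lam (40 * delta).
Proof.
  intros Hq Hsig Hd Hs Hlam.
  assert (Hq' : 0 < / q) by (apply Rinv_0_lt_compat; lra).
  assert (Hqq : / q * q = 1) by (apply Rinv_l; lra).
  exists (fun x => / q * near_int_mass delta (q * tan (x - sigma))).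
  repeat split.
  - intros x y h1 h2 h3. apply Rmult_le_compat_l; [ lra | ].
    apply near_int_mass_le; [ lra | ]. apply Rmult_le_compat_l; [ lra | ].
    pose proof (tan_sub_bounds (x - sigma) (y - sigma)). lra.
  - intros x z y h1 h2 h3 h4 [p Hp].
    pose proof (tan_sub_bounds (x - sigma) (z - sigma)
      ltac:(lra) ltac:(lra) ltac:(lra)) as Hxz.
    pose proof (tan_sub_bounds (z - sigma) (y - sigma)
      ltac:(lra) ltac:(lra) ltac:(lra)) as Hzy.
    assert (H1 : q * (tan (z - sigma) - tan (x - sigma)) <= delta).
    { apply Rle_trans with (q * (2 * s)); [ | lra ].
      apply Rmult_le_compat_l; lra. }
    assert (H2 : q * (tan (y - sigma) - tan (z - sigma)) <= delta).
    { apply Rle_trans with (q * (2 * s)); [ | lra ].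
      apply Rmult_le_compat_l; lra. }
    assert (H3 : 0 <= q * (tan (z - sigma) - tan (x - sigma)))
      by (apply Rmult_le_pos; lra).
    assert (H4 : 0 <= q * (tan (y - sigma) - tan (z - sigma)))
      by (apply Rmult_le_pos; lra).
    apply Rabs_le_between in Hp.
    rewrite <- Rmult_minus_distr_l, (near_int_mass_sub delta _ _ p);
      try (try apply Rabs_le; lra).
    rewrite <- Rmult_minus_distr_l, <- Rmult_assoc, Hqq. lra.
  - intros x y h1 h2 h3.
    assert (0 < y - x) by lra.
    pose proof (tan_sub_bounds (x - sigma) (y - sigma)
      ltac:(lra) ltac:(lra) ltac:(lra)) as Hxy.
    pose proof (near_int_mass_sub_le delta ltac:(lra)
      (q * tan (x - sigma)) (q * tan (y - sigma))) as H1.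
    rewrite <- Rmult_minus_distr_l.
    apply Rle_trans with
      (/ q * (4 * delta * (q * (2 * (y - x)) + 2))).
    + apply Rmult_le_compat_l; [ lra | ]. eapply Rle_trans; [ exact H1 | ].
      apply Rmult_le_compat_l; [ lra | ].
      assert (q * (tan (y - sigma) - tan (x - sigma)) <= q * (2 * (y - x)))
        by (apply Rmult_le_compat_l; lra).
      lra.
    (* [40 = 8 * (1 + 4)]: the tangent at most doubles lengths, and [/ q <= 4 * lam] absorbs the
       boundary term. *)
    + replace (/ q * (4 * delta * (q * (2 * (y - x)) + 2)))
        with (8 * delta * (/ q * q * (y - x) + / q)) by ring.
      rewrite Hqq.
      replace (40 * delta * (y - x))
        with (8 * delta * (1 * (y - x) + 4 * (y - x))) by ring.
      apply Rmult_le_compat_l; lra.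
Qed.

(** * Halving and nested intervals *)

(** Increments over the two halves add up, so one half keeps average slope at most [a]. *)
Lemma halving_descent (G : R -> R) (t : nat) :
  forall x len a, 0 < len -> G (x + len) - G x <= a * len ->
  exists x', x <= x' /\ x' + len / 2 ^ t <= x + len /\
    G (x' + len / 2 ^ t) - G x' <= a * (len / 2 ^ t).
Proof.
  induction t as [ | t IH]; intros x len a Hlen HG.
  - exists x. simpl. replace (len / 1) with len by field. repeat split; lra.
  - assert (E : len / 2 ^ S t = len / 2 / 2 ^ t).
    { simpl. field. apply pow_nonzero. lra. }
    rewrite E.
    destruct (Rle_lt_dec (G (x + len / 2) - G x) (a * (len / 2))) as [H | H].
    + destruct (IH x (len / 2) a) as [x' [h1 [h2 h3]]]; [ lra | exact H | ].
      exists x'. repeat split; lra.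
    + destruct (IH (x + len / 2) (len / 2) a) as [x' [h1 [h2 h3]]]; [ lra | | ].
      { replace (x + len / 2 + len / 2) with (x + len) by field. lra. }
      exists x'. repeat split; lra.
Qed.

Definition thin (P : R -> Prop) (s x len : R) : Prop :=
  exists G, detects G P s /\ G (x + len) - G x <= 1 / 2 * len.

(* Halve repeatedly, keeping the average slope of [G + 2 * H] at most [3 / 4]:
   at the end [G] has slope below 1, so [P] is missed, and [H] has slope at most
   [3 / 8]. *)
Lemma thin_step (P Q : R -> Prop) (s s' lam x len : R) (t : nat) :
  0 < len -> 1 / 2 <= x -> x + len <= 3 / 4 ->
  lam <= len -> len / 2 ^ t <= s ->
  thin P s x len -> sparse Q s' lam (1 / 8) ->
  exists x', x <= x' /\ x' + len / 2 ^ t <= x + len /\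
    (forall z, x' <= z <= x' + len / 2 ^ t -> ~ P z) /\
    thin Q s' x' (len / 2 ^ t).
Proof.
  intros Hlen Hx Hxl Hlam Hs [G [[Gm Gh] Ge]] [H [[Hm Hh] He]].
  assert (Hl' : 0 < len / 2 ^ t).
  { apply Rdiv_lt_0_compat; [ lra | apply pow_lt; lra ]. }
  destruct (halving_descent (fun x => G x + 2 * H x) t x len (3 / 4))
    as [x' [h1 [h2 h3]]]; [ lra | | ].
  { specialize (He x (x + len)). lra. }
  exists x'. split; [ lra | ]. split; [ lra | ]. split.
  - intros z Hz HP.
    specialize (Gh x' z (x' + len / 2 ^ t)).
    specialize (Hm x' (x' + len / 2 ^ t)).
    assert (H x' <= H (x' + len / 2 ^ t)) by (apply Hm; lra).
    assert (len / 2 ^ t <= G (x' + len / 2 ^ t) - G x').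
    { replace (len / 2 ^ t) with (x' + len / 2 ^ t - x') at 1 by ring.
      apply Gh; trivial; lra. }
    lra.
  - exists H. split; [ split; trivial | ].
    assert (G x' <= G (x' + len / 2 ^ t)) by (apply Gm; lra). lra.
Qed.

Lemma nested_thin_avoid (P : nat -> R -> Prop) (s lam : nat -> R)
    (t : nat -> nat) (x0 : R) :
  (forall j, 0 < lam j) ->
  (forall j, lam (S j) = lam j / 2 ^ t j) ->
  (forall j, lam (S j) <= s j) ->
  (forall j, sparse (P (S j)) (s (S j)) (lam j) (1 / 8)) ->
  1 / 2 <= x0 -> x0 + lam 0%nat <= 3 / 4 -> thin (P 0%nat) (s 0%nat) x0 (lam 0%nat) ->
  exists alpha, 1 / 2 <= alpha <= 3 / 4 /\ forall j, ~ P j alpha.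
Proof.
  intros Hlam Ht Hs Hsp Hx0 Hx0l Hth0.
  set (state j x := 1 / 2 <= x /\ x + lam j <= 3 / 4 /\ thin (P j) (s j) x (lam j)).
  (* The implication sits under the existential so that choice yields a total function; outside
     [state] the witness is a dummy 0. *)
  assert (Hstep : forall jx : nat * R, exists x',
    state (fst jx) (snd jx) ->
      state (S (fst jx)) x' /\ snd jx <= x' /\
      x' + lam (S (fst jx)) <= snd jx + lam (fst jx) /\
      forall z, x' <= z <= x' + lam (S (fst jx)) -> ~ P (fst jx) z).
  { intros [j x]; simpl.
    destruct (Rle_dec (1 / 2) x) as [h1 | h1];
      [ | exists 0; intros [h _]; contradiction ].
    destruct (Rle_dec (x + lam j) (3 / 4)) as [h2 | h2];
      [ | exists 0; intros [_ [h _]]; contradiction ].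
    destruct (Classical_Prop.classic (thin (P j) (s j) x (lam j))) as [h3 | h3];
      [ | exists 0; intros [_ [_ h]]; contradiction ].
    destruct (thin_step (P j) (P (S j)) (s j) (s (S j)) (lam j) x (lam j) (t j))
      as [x' [k1 [k2 [k3 k4]]]]; trivial; try lra.
    { rewrite <- Ht. apply Hs. }
    rewrite <- Ht in k2, k3, k4. exists x'. intros _.
    unfold state. repeat split; trivial; lra. }
  apply functional_choice in Hstep. destruct Hstep as [f Hf].
  set (X := nat_rect (fun _ => R) x0 (fun j x => f (j, x))).
  assert (HX : forall j, state j (X j)).
  { induction j as [ | j IH]; [ repeat split; trivial | ].
    exact (proj1 (Hf (j, X j) IH)). }
  assert (HXS : forall j, X j <= X (S j) /\
    X (S j) + lam (S j) <= X j + lam j /\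
    forall z, X (S j) <= z <= X (S j) + lam (S j) -> ~ P j z).
  { intros j. exact (proj2 (Hf (j, X j) (HX j))). }
  assert (Hmono : forall i d, X i <= X (d + i)%nat /\
    X (d + i)%nat + lam (d + i)%nat <= X i + lam i).
  { intros i d. induction d as [ | d IH]; simpl; [ lra | ].
    destruct (HXS (d + i)%nat) as [k1 [k2 _]]. simpl in k1, k2. lra. }
  assert (Hub : forall i j, X i <= X j + lam j).
  { intros i j. pose proof (Hlam i). pose proof (Hlam j).
    destruct (Nat.le_ge_cases i j) as [h | h].
    - destruct (Hmono i (j - i)%nat) as [k _].
      replace (j - i + i)%nat with j in k by lia. lra.
    - destruct (Hmono j (i - j)%nat) as [_ k].
      replace (i - j + j)%nat with i in k by lia. lra. }
  (* The point is the supremum of the left ends; every right end bounds all of them. *)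
  destruct (completeness (fun r => exists j, r = X j)) as [alpha [Ha1 Ha2]].
  { exists (X 0%nat + lam 0%nat). intros r [j ->]. apply Hub. }
  { exists (X 0%nat), 0%nat. reflexivity. }
  assert (Hin : forall j, X j <= alpha <= X j + lam j).
  { intros j. split.
    - apply Ha1. exists j. reflexivity.
    - apply Ha2. intros r [i ->]. apply Hub. }
  exists alpha. split.
  - pose proof (Hin 0%nat) as H0. simpl in H0. lra.
  - intros j. apply (proj2 (proj2 (HXS j))). apply Hin.
Qed.

(** * Blocks of denominators and their density *)

(* Block [j] consists of the denominators [q] with
   [level j <= log_2 q < level (S j)]. *)
Definition level (j : nat) : nat :=
  match j with O => O | S i => 16 * 4 ^ i end.

(** Index 0, free because the theorem has [k >= 1], encodes the absence of a shift. *)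
Definition shift (k : nat) : R :=
  match k with O => 0 | S _ => / 2 ^ k end.

(** With [N = level (S j)], the constant makes the total density [N * (4 * N) * 40 / (1280 * N ^ 2)
    = 1 / 8]. *)
Definition block_gap (j : nat) : R := / (1280 * INR (level (S j)) ^ 2).

Definition bad (j : nat) (z : R) : Prop :=
  exists n, (n < level (S j))%nat /\ (level j <= n)%nat /\
  exists i, (i < 2 ^ n)%nat /\
  exists k, (k < 4 * level (S j))%nat /\
  exists p : Z,
    Rabs (INR (2 ^ n + i) * tan (z - shift k) - IZR p) <= block_gap j / 2 ^ n.

(** The length of [[1/2, 3/4]] after [level j] halvings; four times it is at least [/ q] for every
    [q] in block [j]. *)
Definition block_len (j : nat) : R := / 4 / 2 ^ level j.

Lemma level_SS (j : nat) : level (S (S j)) = (4 * level (S j))%nat.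
Proof. simpl. lia. Qed.

Lemma level_S_ge (j : nat) : (16 <= level (S j))%nat.
Proof. induction j as [ | j IH]; [ simpl; lia | rewrite level_SS; lia ]. Qed.

Lemma level_le_S (j : nat) : (level j <= level (S j))%nat.
Proof. destruct j; [ simpl; lia | rewrite level_SS; lia ]. Qed.

Lemma INR_16 : INR 16 = 16.
Proof. rewrite INR_IZR_INZ. reflexivity. Qed.

Lemma quadratic_le_pow4 (n : nat) : (16 <= n)%nat -> 2560 * INR n ^ 2 <= 4 ^ n.
Proof.
  intros Hn. induction Hn as [ | n Hn IH].
  - rewrite INR_16. lra.
  - rewrite S_INR. apply le_INR in Hn. rewrite INR_16 in Hn. simpl. simpl in IH. nra.
Qed.

Lemma shift_bounds (k : nat) : 0 <= shift k <= 1 / 2.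
Proof.
  destruct k as [ | k]; [ simpl; lra | ]. unfold shift. split.
  - left. apply Rinv_0_lt_compat, pow_lt. lra.
  - replace (1 / 2) with (/ 2) by field. apply Rinv_le_contravar; [ lra | ].
    simpl. pose proof (pow_R1_Rle 2 k). lra.
Qed.

Lemma pow4_pow2 (n : nat) : 4 ^ n = 2 ^ n * 2 ^ n.
Proof. rewrite <- Rpow_mult_distr. f_equal; lra. Qed.

Lemma block_gap_bounds (j : nat) :
  0 < block_gap j < 1 / 4 /\ 2 * / 4 ^ level (S j) <= block_gap j.
Proof.
  unfold block_gap. set (N := INR (level (S j))).
  pose proof (level_S_ge j) as HN.
  pose proof (quadratic_le_pow4 _ HN) as H4. fold N in H4.
  apply le_INR in HN. rewrite INR_16 in HN. fold N in HN.
  assert (256 <= N ^ 2) by nra.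
  repeat split.
  - apply Rinv_0_lt_compat. lra.
  - replace (1 / 4) with (/ 4) by field. apply Rinv_lt_contravar; lra.
  - replace 2 with (/ / 2) by field. rewrite <- Rinv_mult.
    apply Rinv_le_contravar; lra.
Qed.

(** A union bound over at most [N] levels, [2 ^ n] denominators in each and [4 * N] shifts; the
    number of denominators cancels the [2 ^ n] in the radius. *)
Lemma sparse_bad (j : nat) (lam : R) :
  block_len j <= lam -> sparse (bad j) (block_len (S (S j))) lam (1 / 8).
Proof.
  intros Hlam.
  destruct (block_gap_bounds j) as [Hd Hd4].
  assert (Hbl : 0 < block_len j).
  { unfold block_len. apply Rdiv_lt_0_compat; [ lra | apply pow_lt; lra ]. }
  set (N := level (S j)).
  assert (HN : INR N <> 0).
  { apply not_0_INR. pose proof (level_S_ge j). unfold N. lia. }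
  replace (1 / 8) with (INR N * (INR (4 * N) * (40 * block_gap j))).
  2:{ unfold block_gap. fold N. rewrite (mult_INR 4 N). simpl (INR 4). field. exact HN. }
  apply sparse_exists; [ lra | ]. intros n Hn.
  assert (H2n : 0 < 2 ^ n) by (apply pow_lt; lra).
  destruct (Compare_dec.le_dec (level j) n) as [Hjn | Hjn].
  2:{ apply sparse_empty; [ lra | | ].
      - apply Rmult_le_pos; [ apply pos_INR | lra ].
      - intros z [h _]. contradiction. }
  eapply sparse_sub; [ intros z _ [_ h]; exact h | ].
  replace (INR (4 * N) * (40 * block_gap j))
    with (INR (2 ^ n) * (INR (4 * N) * (40 * (block_gap j / 2 ^ n)))).
  2:{ rewrite pow_INR. change (INR 2) with 2. field. lra. }
  apply sparse_exists; [ lra | ]. intros i Hi.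
  apply sparse_exists; [ lra | ]. intros k Hk.
  set (q := INR (2 ^ n + i)).
  assert (Hq : 2 ^ n <= q < 2 * 2 ^ n).
  { unfold q. rewrite plus_INR, pow_INR. change (INR 2) with 2.
    pose proof (pos_INR i). apply lt_INR in Hi. rewrite pow_INR in Hi.
    change (INR 2) with 2 in Hi. lra. }
  apply sparse_tan_near_int.
  - lra.
  - apply shift_bounds.
  - split.
    + apply Rlt_le, Rdiv_lt_0_compat; lra.
    + apply Rle_lt_trans with (block_gap j); [ | lra ].
      apply (proj2 (Rle_div_l _ _ _ H2n)).
      pose proof (pow_R1_Rle 2 n ltac:(lra)). nra.
  (* Here [s = / 4 / 16 ^ N] and [q < 2 * 2 ^ n <= 2 ^ N], so [2 * q * s * 2 ^ n] is at most
     [/ 4 / 4 ^ N], below the gap. *)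
  - apply (proj1 (Rle_div_r _ _ _ H2n)).
    assert (Hpow : 4 * 2 ^ n * 2 ^ n <= 4 ^ N).
    { replace (4 * 2 ^ n * 2 ^ n) with (4 ^ S n)
        by (simpl; rewrite pow4_pow2; ring).
      apply Rle_pow; [ lra | ]. unfold N. lia. }
    unfold block_len. rewrite level_SS. fold N.
    rewrite pow_mult. replace (2 ^ 4) with (4 * 4) by ring.
    rewrite Rpow_mult_distr.
    assert (H4N : 0 < 4 ^ N) by (apply pow_lt; lra).
    set (s := / 4 / (4 ^ N * 4 ^ N)).
    assert (Hs : 0 < s).
    { unfold s. apply Rdiv_lt_0_compat; [ lra | nra ]. }
    apply Rle_trans with (4 ^ N * s).
    + apply Rle_trans with (4 * 2 ^ n * 2 ^ n * s);
        [ | apply Rmult_le_compat_r; lra ].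
      assert (q * (2 ^ n * s) <= 2 * 2 ^ n * (2 ^ n * s))
        by (apply Rmult_le_compat_r; nra).
      nra.
    + unfold s. replace (4 ^ N * (/ 4 / (4 ^ N * 4 ^ N))) with (/ 4 * / 4 ^ N)
        by (field; lra).
      assert (0 < / 4 ^ N) by (apply Rinv_0_lt_compat; lra).
      fold N in Hd4. lra.
  - apply Rle_trans with (4 * block_len j); [ | lra ].
    unfold block_len. replace (4 * (/ 4 / 2 ^ level j)) with (/ 2 ^ level j)
      by (field; apply pow_nonzero; lra).
    apply Rinv_le_contravar; [ apply pow_lt; lra | ].
    apply Rle_trans with (2 ^ n); [ | lra ]. apply Rle_pow; [ lra | exact Hjn ].
Qed.

Lemma block_len_div (i j : nat) :
  (level i <= level j)%nat ->
  block_len j = block_len i / 2 ^ (level j - level i).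
Proof.
  intros H. unfold block_len.
  replace (level j) with (level i + (level j - level i))%nat at 1 by lia.
  rewrite pow_add. field. split; apply pow_nonzero; lra.
Qed.

Lemma exists_avoiding : exists alpha, 1 / 2 <= alpha <= 3 / 4 /\ forall j, ~ bad j alpha.
Proof.
  assert (Hpos : forall j, 0 < block_len j).
  { intros j. unfold block_len. apply Rdiv_lt_0_compat; [ lra | apply pow_lt; lra ]. }
  assert (H0 : block_len 0 = 1 / 4) by (unfold block_len; simpl; field).
  destruct (sparse_bad 0 (block_len 0)) as [G [HG Ge]]; [ lra | ].
  (* Block 0 has density at most 1/8 in [[1/2, 3/4]]; halving carries this bound down to length
     [block_len 1], the initial interval. *)
  destruct (halving_descent G (level 1 - level 0) (1 / 2) (1 / 4) (1 / 8))
    as [x0 [h1 [h2 h3]]]; [ lra | | ].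
  { specialize (Ge (1 / 2) (1 / 2 + 1 / 4)). lra. }
  rewrite <- H0, <- (block_len_div 0 1) in h2, h3 by apply level_le_S.
  pose proof (Hpos 1%nat).
  apply (nested_thin_avoid bad (fun j => block_len (S (S j)))
    (fun j => block_len (S j)) (fun j => level (S (S j)) - level (S j))%nat x0).
  - intros j. apply Hpos.
  - intros j. apply block_len_div, level_le_S.
  - intros j. lra.
  - intros j. apply sparse_bad. lra.
  - lra.
  - lra.
  - exists G. split; [ exact HG | lra ].
Qed.

(** * Locating a denominator in its block, and the conclusion *)

Lemma exists_level (n : nat) : exists j, (level j <= n < level (S j))%nat.
Proof.
  induction n as [ | n [j Hj]].
  - exists 0%nat. simpl. lia.
  - destruct (Nat.eq_dec (S n) (level (S j))) as [E | E].
    + exists (S j). pose proof (level_S_ge j). rewrite level_SS. lia.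
    + exists j. lia.
Qed.

Lemma le_log (n : nat) (q : R) : 2 ^ n <= q -> INR n <= log q.
Proof.
  intros Hq. unfold log. eapply Rle_trans; [ | apply Rmax_r ].
  assert (0 < 2 ^ n) by (apply pow_lt; lra).
  assert (Hln2 : 0 < ln 2) by (rewrite <- ln_1; apply ln_increasing; lra).
  apply (proj1 (Rle_div_r _ _ _ Hln2)).
  rewrite <- ln_pow by lra. apply ln_le; lra.
Qed.

Theorem lemma2p9 :
  exists alpha C : R,
    0 <= alpha <= PI / 2 /\ 0 < C /\
    forall (k : nat) (p : Z) (q : nat),
      (1 <= k)%nat -> (1 <= q)%nat ->
      Rabs (tan (alpha - / 2 ^ k) - IZR p / INR q)
        > C / (INR q ^ 2 * log (INR q) ^ 2).
Proof.
  destruct exists_avoiding as [alpha [Ha Hbad]].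
  (* [655360 = 2560 * 16 ^ 2]: half of [block_gap] accounts for 2560, and [N <= 16 * log Q] for the
     square. *)
  exists alpha, (/ 655360). pose proof PI2_3_2.
  split; [ lra | ]. split; [ lra | ].
  intros k p q Hk Hq. apply Rnot_le_gt. intros Hle.
  destruct (Nat.log2_spec q) as [Hq1 Hq2]; [ lia | ].
  set (n := Nat.log2 q) in *.
  destruct (exists_level n) as [j [Hj1 Hj2]].
  apply (Hbad j). exists n. split; [ exact Hj2 | ]. split; [ exact Hj1 | ].
  exists (q - 2 ^ n)%nat. simpl in Hq2. split; [ lia | ].
  replace (2 ^ n + (q - 2 ^ n))%nat with q by lia.
  assert (HQ : 2 ^ n <= INR q < 2 * 2 ^ n).
  { apply le_INR in Hq1. apply lt_INR in Hq2.
    rewrite !plus_INR in Hq2. rewrite pow_INR in Hq1, Hq2.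
    change (INR 2) with 2 in *. simpl (INR 0) in Hq2. lra. }
  set (Q := INR q) in *.
  set (N := level (S j)) in *.
  assert (H2n : 0 < 2 ^ n) by (apply pow_lt; lra).
  assert (HN : 16 <= INR N <= 16 * log Q).
  { pose proof (level_S_ge j) as h. fold N in h. apply le_INR in h.
    rewrite INR_16 in h. split; [ exact h | ].
    assert (h1 : 1 <= log Q) by apply Rmax_l.
    assert (h2 : INR n <= log Q) by (apply le_log; lra).
    (* In block 0 the truncation [log Q >= 1] is what gives the bound; in later blocks [N] is four
       times the lower end, which is at most [n]. *)
    unfold N. destruct j as [ | j].
    - change (level 1) with 16%nat. rewrite INR_16. lra.
    - rewrite level_SS, (mult_INR 4). apply le_INR in Hj1. simpl (INR 4).
      pose proof (pos_INR (level (S j))). lra. }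
  assert (HL : Q * (/ 655360 / (Q ^ 2 * log Q ^ 2)) <= block_gap j / 2 / 2 ^ n).
  { unfold block_gap. fold N.
    replace (Q * (/ 655360 / (Q ^ 2 * log Q ^ 2)))
      with (/ (Q * (2560 * (16 * log Q) ^ 2))) by (field; lra).
    replace (/ (1280 * INR N ^ 2) / 2 / 2 ^ n)
      with (/ (2 ^ n * (2560 * INR N ^ 2))) by (field; lra).
    assert (0 < INR N ^ 2) by (apply pow_lt; lra).
    assert (INR N ^ 2 <= (16 * log Q) ^ 2) by (apply pow_incr; lra).
    apply Rinv_le_contravar; [ apply Rmult_lt_0_compat; lra | ].
    apply Rmult_le_compat; lra. }
  (* The other half of the gap is reserved for replacing a tiny shift by 0. *)
  assert (Hp : Rabs (Q * tan (alpha - / 2 ^ k) - IZR p) <= block_gap j / 2 / 2 ^ n).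
  { replace (Q * tan (alpha - / 2 ^ k) - IZR p)
      with (Q * (tan (alpha - / 2 ^ k) - IZR p / Q)) by (field; lra).
    rewrite Rabs_mult, (Rabs_pos_eq Q) by lra.
    eapply Rle_trans; [ | exact HL ]. apply Rmult_le_compat_l; lra. }
  destruct (block_gap_bounds j) as [Hd Hd4]. fold N in Hd4.
  assert (Hgap : 0 < block_gap j / 2 / 2 ^ n) by (repeat apply Rdiv_lt_0_compat; lra).
  assert (Hgap2 : block_gap j / 2 ^ n = block_gap j / 2 / 2 ^ n + block_gap j / 2 / 2 ^ n)
    by (field; lra).
  destruct (Compare_dec.le_lt_dec (4 * N) k) as [HkN | HkN].
  - (* The shift [/ 2 ^ k] is below the resolution of the block, so it can be
       replaced by the shift 0. *)
    exists 0%nat. split; [ lia | ]. exists p. simpl shift. rewrite Rminus_0_r.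
    assert (Hk2 : 0 < / 2 ^ k <= / (4 ^ N * 4 ^ N)).
    { split; [ apply Rinv_0_lt_compat, pow_lt; lra | ].
      apply Rinv_le_contravar.
      - apply Rmult_lt_0_compat; apply pow_lt; lra.
      - rewrite <- Rpow_mult_distr. replace (4 * 4) with (2 ^ 4) by ring.
        rewrite <- pow_mult. apply Rle_pow; [ lra | exact HkN ]. }
    assert (Hsh : / 2 ^ k <= 1 / 2).
    { destruct k; [ lia | ]. apply (shift_bounds (S k)). }
    destruct (tan_sub_bounds (alpha - / 2 ^ k) alpha) as [T1 T2]; try lra.
    assert (H4N : 0 < 4 ^ N) by (apply pow_lt; lra).
    assert (HD : Q * (tan alpha - tan (alpha - / 2 ^ k)) <= block_gap j / 2 / 2 ^ n).
    { apply (proj1 (Rle_div_r _ _ _ H2n)).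
      assert (Hpow : 4 * 2 ^ n * 2 ^ n <= 4 ^ N).
      { replace (4 * 2 ^ n * 2 ^ n) with (4 ^ S n)
          by (simpl; rewrite pow4_pow2; ring).
        apply Rle_pow; [ lra | lia ]. }
      apply Rle_trans with (4 ^ N * / (4 ^ N * 4 ^ N)).
      - apply Rle_trans with (4 * 2 ^ n * 2 ^ n * / 2 ^ k).
        + replace (4 * 2 ^ n * 2 ^ n * / 2 ^ k)
            with (2 * 2 ^ n * (2 * / 2 ^ k) * 2 ^ n) by ring.
          apply Rmult_le_compat_r; [ lra | ].
          apply Rmult_le_compat; lra.
        + apply Rmult_le_compat; nra.
      - replace (4 ^ N * / (4 ^ N * 4 ^ N)) with (/ 4 ^ N) by (field; lra). lra. }
    assert (0 <= Q * (tan alpha - tan (alpha - / 2 ^ k)))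
      by (apply Rmult_le_pos; lra).
    apply Rabs_le_between in Hp. apply Rabs_le. lra.
  - exists k. split; [ exact HkN | ]. exists p.
    destruct k as [ | k]; [ lia | ]. unfold shift. lra.
Qed.
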